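(* Let $s$ be a positive integer, let $f:\mathbb{N}\to\mathbb{C}$ be an arithmetical function, and let $f'(k)=\sum_{d\mid k}\mu(d)f(k/d)$. Suppose $$\sum_{k=1}^{\infty}2^{\omega(k)}\frac{|f'(k)|}{k^s}<\infty .$$ For each $q\ge 1$ put $a_q=\sum_{m=1}^{\infty}\frac{f'(mq)}{(mq)^s}$. Then for every positive integer $n$ the series $\sum_{q=1}^{\infty}a_q\,c_q^{(s)}(n^s)$ converges absolutely (indeed $\sum_{q\ge1}\sum_{m\ge1}\frac{|f'(mq)|}{(mq)^s}|c_q^{(s)}(n^s)|<\infty$), and its sum equals $f(n)$.
   Context: For positive integers $a,b,s$, the generalized gcd $(a,b)_s$ is the largest $d^s$ ($d\in\mathbb{N}$) such that $d^s\mid a$ and $d^s\mid b$. The Cohen–Ramanujan sum is defined for positive integers $q,n,s$ by $$c_q^{(s)}(n)=\sum_{\substack{h=1\\ (h,q^s)_s=1}}^{q^s} e^{2\pi i n h/q^s}.$$ $\mu$ is the Möbius function and $\omega(k)$ is the number of distinct prime divisors of $k$. *)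

(* Defs.v *)
From Stdlib Require Import Reals.
From Coquelicot Require Import Coquelicot.
From mathcomp Require Import ssreflect ssrfun ssrbool eqtype ssrnat seq div
  prime fintype bigop.
Local Open Scope nat_scope.

Definition omega (k : nat) : nat := size (primes k).

Definition squarefreeb (k : nat) : bool := all (fun p => logn p k == 1) (primes k).

Definition moebius (k : nat) : R :=
  if squarefreeb k then pow (-1)%R (omega k) else 0%R.

(* generalized gcd (a,b)_s = largest d^s with d^s | a and d^s | b.
   For a >= 1 every such d satisfies d <= a, so ranging d over 0..a suffices. *)
Definition gen_gcd (a b s : nat) : nat :=
  \max_(d < a.+1 | (d ^ s %| a) && (d ^ s %| b)) d ^ s.

Definition cis (t : R) : C := (cos t, sin t).

Definition cohen_ramanujan (q s n : nat) : C :=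
  sum_n_m (fun h : nat =>
     if gen_gcd h (q ^ s) s == 1
     then cis (2 * PI * (INR n * INR h / INR (q ^ s)))%R
     else RtoC 0%R) 1 (q ^ s).

Definition mobius_conv (f : nat -> C) (k : nat) : C :=
  sum_n_m (fun d : nat =>
     if d %| k then (RtoC (moebius d) * f (k %/ d))%C else RtoC 0%R) 1 k.

Definition CSeries (u : nat -> C) : C :=
  (Series (fun k => Re (u k)), Series (fun k => Im (u k))).

Definition coef_a (f : nat -> C) (s q : nat) : C :=
  CSeries (fun m => (mobius_conv f (m.+1 * q) / RtoC (pow (INR (m.+1 * q)) s))%C).

(* Main.v *)
(** Let [g k = k^s] if [k] divides [n] and [g k = 0] otherwise.  Since the [d] with
    [d | q] and [d^s | h] are the divisors of a single integer, the condition
    [(h, q^s)_s = 1] can be detected by a sum of [mu]; summing roots of unity then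
    gives [c_q(n^s) = sum_(d | q) mu(d) g(q/d)].  Hence [sum_(q | k) c_q(n^s) = g k]
    and [sum_(q | k) |c_q(n^s)| <= 2^omega(k) sum_(e | n) e^s].  The second estimate
    makes the double series over [q] and [m] absolutely convergent, so that it can be
    regrouped by [k = m q] into
    [sum_k f'(k)/k^s sum_(q | k) c_q(n^s) = sum_(k | n) f'(k) = f(n)]. *)

Require Import Defs.
From HB Require Import structures.
From Stdlib Require Import Reals Lra Lia.
From Coquelicot Require Import Coquelicot.
From mathcomp Require ssreflect ssrfun ssrbool eqtype ssrnat seq div prime fintype bigop.
Open Scope R_scope.

(* MathComp is imported inside the section only: at top level it would change
   the meaning of [(0 < s)%nat], [*] and [^] in the theorem. *)
Section DivisorSums.

Set Implicit Arguments.
Unset Strict Implicit.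
Unset Printing Implicit Defensive.

Import ssreflect ssrfun ssrbool eqtype ssrnat seq div prime fintype bigop.

Local Notation "\sumR_ ( i <- r ) F" := (\big[Rplus/R0]_(i <- r) F)
  (at level 41, F at level 41, i, r at level 50).
Local Notation "\sumC_ ( i <- r ) F" := (\big[Cplus/RtoC R0]_(i <- r) F)
  (at level 41, F at level 41, i, r at level 50).

HB.instance Definition _ := Monoid.isComLaw.Build R R0 Rplus
  (fun x y z => esym (Rplus_assoc x y z)) Rplus_comm Rplus_0_l.
HB.instance Definition _ := Monoid.isComLaw.Build C (RtoC R0) Cplus
  Cplus_assoc Cplus_comm Cplus_0_l.

(** * Divisor sums of the Moebius function and of its absolute value *)

Lemma mem_divisors_gt0 (n d : nat) : (0 < n)%N -> d \in divisors n -> (0 < d)%N.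
Proof. by move=> n0; rewrite -dvdn_divisors // => /dvdn_gt0; apply. Qed.

Lemma perm_primes_mul (p e : nat) :
  prime p -> ~~ (p %| e) -> perm_eq (primes (p * e)) (p :: primes e).
Proof.
move=> pp pe; have e0 : (0 < e)%N by case: e pe => //; rewrite dvdn0.
apply: uniq_perm; first exact: primes_uniq.
  by rewrite /= primes_uniq andbT mem_primes (negbTE pe) !andbF.
by move=> q; rewrite primesM ?(prime_gt0 pp) // primes_prime // !in_cons orbF.
Qed.

(** A new prime factor of exponent one leaves squarefreeness unchanged and raises [omega] by one. *)
Lemma moebius_mul_prime (p e : nat) :
  prime p -> ~~ (p %| e) -> moebius (p * e) = - moebius e.
Proof.
move=> pp pe; have e0 : (0 < e)%N by case: e pe => //; rewrite dvdn0.
have pr := perm_primes_mul pp pe.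
have -> : moebius (p * e) = if squarefreeb e then (-1) ^ (omega e).+1 else 0.
  rewrite /moebius /omega (perm_size pr) /squarefreeb (perm_all _ pr) /=.
  rewrite lognM ?(prime_gt0 pp) // logn_prime // eqxx.
  have -> : logn p e = 0%N by apply/eqP; rewrite -[_ == _]negbK -lt0n logn_gt0 mem_primes pp e0.
  rewrite andTb; congr (if _ then _ else _).
  apply: eq_in_all => q; rewrite mem_primes => /and3P[pq _ qe].
  rewrite lognM ?(prime_gt0 pp) // logn_prime //; case: (q =P p) => // qp.
  by rewrite -qp qe in pe.
by rewrite /moebius; case: ifP => _ /=; ring.
Qed.

Lemma moebius_not_squarefree (p e : nat) :
  prime p -> (0 < e)%N -> p %| e -> moebius (p * e) = 0.
Proof.
move=> pp e0 pe; rewrite /moebius ifF //; apply/negP => /allP/(_ p).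
rewrite mem_primes pp muln_gt0 prime_gt0 // e0 dvdn_mulr // => /(_ isT).
rewrite lognM ?(prime_gt0 pp) // logn_prime // eqxx.
by have : (0 < logn p e)%N; [rewrite logn_gt0 mem_primes pp e0 | case: (logn p e)].
Qed.

Lemma dvdn_partC (p n d : nat) :
  prime p -> (0 < n)%N -> (d %| n`_p^') = (d %| n) && ~~ (p %| d).
Proof.
move=> pp n0; apply/idP/andP => [dn | [dn pd]].
  split; first exact: dvdn_trans dn (dvdn_part _ _).
  apply/negP => pd; have := dvdn_trans pd dn.
  have: coprime p n`_p^'.
    by rewrite -[p in coprime p _](@part_pnat_id p p) ?coprime_partC // pnat_id.
  by rewrite prime_coprime // => /negbTE ->.
have d0 : (0 < d)%N by apply: dvdn_gt0 dn.
have dp : p^'.-nat d by rewrite p'natE.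
by rewrite -(part_pnat_id dp); apply: partn_dvd.
Qed.

(** The divisors of [n] are sorted by their exponent of [p]. Exponent 0 gives the divisors [d] of
    the p'-part of [n], exponent 1 gives the products [p * d], and [F] vanishes on all higher
    exponents. *)
Lemma sum_divisors_prime (F : nat -> R) (p n : nat) :
  prime p -> (0 < n)%N -> p %| n ->
  (forall e, (0 < e)%N -> p %| e -> F (p * e)%N = 0) ->
  \sumR_(d <- divisors n) F d =
  \sumR_(d <- divisors n`_p^') (F d + F (p * d)%N).
Proof.
move=> pp n0 pn F0; rewrite big_split /= (bigID (fun d => p %| d)) /= Rplus_comm.
have m0 : (0 < n`_p^')%N by [].
have inm d : d \in divisors n`_p^' = (d %| n) && ~~ (p %| d).
  by rewrite -dvdn_divisors // dvdn_partC.
congr Rplus.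
  rewrite -big_filter; apply: perm_big; apply: uniq_perm.
  - exact: filter_uniq (divisors_uniq _).
  - exact: divisors_uniq.
  by move=> d; rewrite mem_filter inm -dvdn_divisors // andbC.
(* Among the multiples of [p], those divisible by the square of [p] contribute 0. *)
rewrite (bigID (fun d => p %| d %/ p)) /= big1_seq ?Rplus_0_l; last first.
  move=> d /andP[/andP[pd pdp] dn].
  rewrite -(divnK pd) mulnC F0 // divn_gt0 ?prime_gt0 //.
  by apply: dvdn_leq => //; apply: mem_divisors_gt0 dn.
rewrite -big_filter -[RHS](@big_map _ _ _ _ _ (muln p) _ xpredT F).
apply: perm_big; apply: uniq_perm.
- exact: filter_uniq (divisors_uniq _).
- rewrite map_inj_uniq ?divisors_uniq // => a b /eqP.
  by rewrite eqn_pmul2l ?prime_gt0 // => /eqP.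
move=> d; rewrite mem_filter -dvdn_divisors //; apply/idP/mapP.
  case/andP=> /andP[pd pdp] dn; exists (d %/ p)%N; last by rewrite mulnC divnK.
  by rewrite inm pdp andbT; apply: dvdn_trans dn; rewrite dvdn_div.
case=> e; rewrite inm => /andP[en pe] ->.
rewrite dvdn_mulr // mulKn ?prime_gt0 // pe /= Gauss_dvd ?pn //.
by rewrite prime_coprime.
Qed.

(** Splitting off the least prime [p] of [n] pairs [d] with [p * d], and the two values of [moebius]
    cancel. *)
Lemma sum_moebius (n : nat) :
  (0 < n)%N -> \sumR_(d <- divisors n) moebius d = if n == 1%N then 1 else 0.
Proof.
move=> n0; case: eqP => [-> | /eqP n1].
  by rewrite big_seq1 /moebius.
have n2 : (1 < n)%N by case: n n0 n1 => [|[]].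
have pp := pdiv_prime n2.
rewrite (sum_divisors_prime pp) ?pdiv_dvd //; last first.
  by move=> e e0 pe; exact: (moebius_not_squarefree pp).
rewrite big1_seq // => d /=; rewrite -dvdn_divisors // dvdn_partC // => /andP[_ pd].
by rewrite moebius_mul_prime // Rplus_opp_r.
Qed.

(** The same pairing now adds equal terms. Each prime thus contributes a factor 2, and strong
    induction passes from [n] to its p'-part, which has one prime fewer. *)
Lemma sum_abs_moebius (n : nat) :
  (0 < n)%N -> \sumR_(d <- divisors n) Rabs (moebius d) = 2 ^ omega n.
Proof.
have [k] := ubnP n; elim: k n => // k IH n; rewrite ltnS => nk n0.
have [n2 | n1] := ltnP 1 n; last first.
  have -> : n = 1%N by case: n n0 n1 {nk} => [|[]].
  by rewrite big_seq1 /moebius /= Rabs_R1.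
have pp := pdiv_prime n2; set p := pdiv n in pp.
have pn : p %| n := pdiv_dvd n.
rewrite (sum_divisors_prime (p := p)) //; last first.
  by move=> e e0 pe; rewrite moebius_not_squarefree // Rabs_R0.
have pr : perm_eq (primes n) (p :: primes n`_p^').
  apply: uniq_perm; first exact: primes_uniq.
    by rewrite /= primes_uniq andbT primes_part mem_filter !inE eqxx.
  move=> q; rewrite primes_part in_cons mem_filter !inE.
  by case: eqP => // ->; rewrite mem_primes pp n0.
have mn : (n`_p^' < n)%N.
  rewrite ltn_neqAle dvdn_leq ?dvdn_part // andbT; apply/eqP => e.
  by have := dvdn_partC n pp n0; rewrite e dvdnn pn.
rewrite /omega (perm_size pr) /= -/(omega _) -IH //; last exact: leq_trans mn nk.
rewrite (big_morph _ (Rmult_plus_distr_l 2) (Rmult_0_r 2)).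
apply: eq_big_seq => d; rewrite -dvdn_divisors // dvdn_partC // => /andP[_ pd].
by rewrite moebius_mul_prime // Rabs_Ropp; ring.
Qed.

(** * Reordering and inverting divisor sums *)

(** The map sending [(k, d)] to [(d, k / d)] is a bijection from the chains d | k | n onto the pairs
    [(d, e)] with de | n. *)
Lemma sum_divisors_swap (T : Type) (idx : T) (op : Monoid.com_law idx)
    (F : nat -> nat -> T) (n : nat) : (0 < n)%N ->
  \big[op/idx]_(k <- divisors n) \big[op/idx]_(d <- divisors k) F d (k %/ d)%N =
  \big[op/idx]_(e <- divisors n) \big[op/idx]_(d <- divisors (n %/ e)) F d e.
Proof.
move=> n0; pose G (x : nat * nat) := F x.1 x.2.
rewrite -(big_allpairs_dep (h := fun k d : nat => (d, (k %/ d)%N)) (F := G)).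
rewrite -(big_allpairs_dep (h := fun e d : nat => (d, e)) (F := G)).
apply: perm_big; apply: uniq_perm.
- apply: allpairs_uniq_dep => [|k _|]; try exact: divisors_uniq.
  case=> k1 d1 [k2 d2] /allpairsPdep[x1 [y1 [x1n y1x [-> ->]]]].
  move=> /allpairsPdep[x2 [y2 [x2n y2x [-> ->]]]] /= [y12 xy].
  move: y1x y2x; rewrite -!dvdn_divisors ?(mem_divisors_gt0 n0) // => y1x y2x.
  by rewrite y12 -(divnK y1x) xy y12 (divnK y2x).
- apply: allpairs_uniq_dep => [|k _|]; try exact: divisors_uniq.
  by case=> k1 d1 [k2 d2] _ _ /= [-> ->].
case=> d e; apply/allpairsPdep/allpairsPdep => [[k [x [kn xk [-> ->]]]] | ].
  have k0 := mem_divisors_gt0 n0 kn; move: xk kn; rewrite -!dvdn_divisors // => xk kn.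
  have en : (k %/ x)%N %| n by apply: dvdn_trans kn; exact: dvdn_div.
  have x0 : (0 < x)%N by apply: dvdn_gt0 xk.
  have e0 : (0 < k %/ x)%N by rewrite divn_gt0 // dvdn_leq.
  exists (k %/ x)%N, x; split=> [||//].
    by rewrite -dvdn_divisors.
  rewrite -dvdn_divisors; last by rewrite divn_gt0 // dvdn_leq.
  by rewrite dvdn_divRL // mulnC divnK.
case=> e' [x [en xe [-> ->]]].
have e0 := mem_divisors_gt0 n0 en; move: en; rewrite -dvdn_divisors // => en.
have ne0 : (0 < n %/ e')%N by rewrite divn_gt0 // dvdn_leq.
move: xe; rewrite -dvdn_divisors // dvdn_divRL // => xn.
have xe0 := dvdn_gt0 n0 xn.
have x0 : (0 < x)%N by move: xe0; rewrite muln_gt0 => /andP[].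
exists (x * e')%N, x; split; last by rewrite mulKn.
  by rewrite -dvdn_divisors.
by rewrite -dvdn_divisors // dvdn_mulr.
Qed.

(** After the swap, [g e] is multiplied by the sum of [moebius] over the divisors of [n / e], which
    is 0 unless [e = n]. It is used twice: for the coefficients f' and for the Ramanujan sums. *)
Lemma moebius_inversion (g : nat -> R) (n : nat) : (0 < n)%N ->
  \sumR_(k <- divisors n) (\sumR_(d <- divisors k) moebius d * g (k %/ d)%N) = g n.
Proof.
move=> n0; rewrite (sum_divisors_swap _ (fun d e => moebius d * g e) n0).
rewrite (bigD1_seq n) ?divisors_id ?divisors_uniq //= divnn n0.
rewrite big_seq1 big1_seq => [|e /andP[en]].
  by rewrite /moebius /=; ring.
move=> edn; have e0 := mem_divisors_gt0 n0 edn; move: edn; rewrite -dvdn_divisors // => edn.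
rewrite -(big_morph (fun x => x * g e) (fun x y => Rmult_plus_distr_r x y _) (Rmult_0_l _)).
have ne0 : (0 < n %/ e)%N by rewrite divn_gt0 // dvdn_leq.
have ne1 : (n %/ e == 1)%N = false.
  by apply/negP => /eqP ne1; move: en; rewrite -(divnK edn) ne1 mul1n eqxx.
rewrite sum_moebius; [rewrite ne1; ring | exact: ne0].
Qed.

(** * Sums over multiples, and the convolution f' as a divisor sum *)

(** The general law [op] covers both the complex sums of roots of unity and the real partial sums of
    series. *)
Lemma big_multiples (T : Type) (idx : T) (op : Monoid.com_law idx)
    (F : nat -> T) (q M : nat) : (0 < q)%N ->
  \big[op/idx]_(1 <= k < (M * q).+1 | q %| k) F k =
  \big[op/idx]_(1 <= m < M.+1) F (m * q)%N.
Proof.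
move=> q0; rewrite -big_filter -(@big_map _ _ _ _ _ (muln^~ q) _ xpredT F).
apply: perm_big; apply: uniq_perm.
- exact: filter_uniq (iota_uniq _ _).
- rewrite map_inj_uniq ?iota_uniq // => a b /eqP.
  by rewrite eqn_pmul2r // => /eqP.
move=> k; rewrite mem_filter mem_index_iota; apply/idP/mapP.
  case/and3P=> qk k0 kM; exists (k %/ q)%N; last by rewrite divnK.
  rewrite mem_index_iota divn_gt0 // dvdn_leq //= ltnS.
  by rewrite -(leq_pmul2r q0) divnK.
case=> m; rewrite mem_index_iota => /andP[m0 mM] ->.
by rewrite dvdn_mull //= muln_gt0 m0 q0 ltnS leq_pmul2r.
Qed.

Lemma sum_n_m_bigC (u : nat -> C) (m : nat) :
  sum_n_m u 1 m = \big[Cplus/RtoC 0]_(1 <= i < m.+1) u i.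
Proof.
elim: m => [|m IH]; first by rewrite big_geq // sum_n_m_zero //; lia.
by rewrite big_nat_recr //= -IH sum_n_Sm //; apply/leP.
Qed.

Lemma mobius_convE (f : nat -> C) (k : nat) : (0 < k)%N ->
  mobius_conv f k = \sumC_(d <- divisors k) (RtoC (moebius d) * f (k %/ d)%N)%C.
Proof.
move=> k0; rewrite /mobius_conv sum_n_m_bigC -big_mkcond -big_filter.
apply: perm_big; apply: uniq_perm.
- exact: filter_uniq (iota_uniq _ _).
- exact: divisors_uniq.
move=> d; rewrite mem_filter mem_index_iota -dvdn_divisors // ltnS.
by case dk: (d %| k) => //=; rewrite (dvdn_gt0 k0 dk) dvdn_leq.
Qed.

(** Because [moebius] is real, f' splits into the convolutions of the two parts of [f], to which the
    real inversion applies. *)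
Lemma Re_mobius_conv (f : nat -> C) (k : nat) : (0 < k)%N ->
  Re (mobius_conv f k) = \sumR_(d <- divisors k) moebius d * Re (f (k %/ d)%N).
Proof.
move=> k0; rewrite mobius_convE // (big_morph Re (id1 := 0) (op1 := Rplus)) //.
by apply: eq_bigr => d _; rewrite re_scal_l.
Qed.

Lemma Im_mobius_conv (f : nat -> C) (k : nat) : (0 < k)%N ->
  Im (mobius_conv f k) = \sumR_(d <- divisors k) moebius d * Im (f (k %/ d)%N).
Proof.
move=> k0; rewrite mobius_convE // (big_morph Im (id1 := 0) (op1 := Rplus)) //.
by apply: eq_bigr => d _; rewrite im_scal_l.
Qed.

(** * The generalized gcd condition as a sum of the Moebius function *)

(** With [g] the gcd, d = ag and e = bg for coprime a and b, and the lcm is abg. Once [g ^ s] is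
    cancelled, the coprime numbers a^s and b^s divide the same quotient, hence so does their
    product. *)
Lemma dvdn_exp_lcm (s h d e : nat) : (0 < d)%N ->
  d ^ s %| h -> e ^ s %| h -> lcmn d e ^ s %| h.
Proof.
move=> d0 dh eh; have g0 : (0 < gcdn d e)%N by rewrite gcdn_gt0 d0.
set g := gcdn d e in g0 *.
have da := divnK (dvdn_gcdl d e); have eb := divnK (dvdn_gcdr d e).
rewrite -/g in da eb; set a := (d %/ g)%N in da; set b := (e %/ g)%N in eb.
have cab : coprime a b.
  by rewrite /coprime -(eqn_pmul2r g0) mul1n muln_gcdl da eb.
have -> : lcmn d e = (a * b * g)%N.
  by apply/eqP; rewrite -(eqn_pmul2r g0) muln_lcm_gcd -{1}da -{1}eb mulnACA mulnA.
have gh : g ^ s %| h.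
  by apply: dvdn_trans dh; apply: dvdn_exp2r; exact: dvdn_gcdl.
move: dh eh; rewrite -{1}da -{1}eb -(divnK gh) !expnMn.
have gs0 : (0 < g ^ s)%N by rewrite expn_gt0 g0.
by rewrite !dvdn_pmul2r // Gauss_dvd ?coprimeXl ?coprimeXr // => -> ->.
Qed.

(** The witness [D] is the lcm of all admissible [d]; by the preceding lemma it is itself
    admissible. *)
Lemma power_gcd_exists (s q h : nat) : (0 < q)%N ->
  exists2 D, (0 < D)%N & forall d, (d %| q) && (d ^ s %| h) = (d %| D).
Proof.
move=> q0; pose D := \big[lcmn/1%N]_(d <- divisors q | d ^ s %| h) d.
have /andP[Dq Dh] : (D %| q) && (D ^ s %| h).
  rewrite /D big_seq_cond.
  apply: (big_ind (fun x => (x %| q) && (x ^ s %| h))) => [|x y|x].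
  - by rewrite exp1n !dvd1n.
  - case/andP=> xq xh /andP[yq yh]; rewrite dvdn_lcm xq yq /=.
    by rewrite dvdn_exp_lcm // (dvdn_gt0 q0 xq).
  - by rewrite -dvdn_divisors // => /andP[-> ->].
exists D; first exact: dvdn_gt0 Dq.
move=> d; apply/andP/idP => [[dq dh] | dD].
  rewrite /D big_mkcond (bigD1_seq d) ?divisors_uniq -?dvdn_divisors //= dh.
  exact: dvdn_lcml.
by split; [exact: dvdn_trans Dq | apply: dvdn_trans Dh; exact: dvdn_exp2r].
Qed.

Lemma gen_gcd_power (s q h D : nat) : (0 < s)%N -> (0 < h)%N -> (0 < D)%N ->
  (forall d, (d %| q) && (d ^ s %| h) = (d %| D)) -> gen_gcd h (q ^ s) s = (D ^ s)%N.
Proof.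
move=> s0 h0 D0 HD; apply/eqP; rewrite eqn_leq; apply/andP; split.
  apply/bigmax_leqP => d; rewrite dvdn_pexp2r // andbC HD => dD.
  by rewrite leq_exp2r // dvdn_leq.
have /andP[Dq Dh] : (D %| q) && (D ^ s %| h) by rewrite HD.
(* The maximum in [gen_gcd] ranges over d <= h only; [D] is in range since D <= D^s <= h. *)
have Dlt : (D < h.+1)%N.
  rewrite ltnS (leq_trans _ (dvdn_leq h0 Dh)) //.
  by rewrite -{1}(expn1 D) leq_pexp2l.
apply: (leq_bigmax_cond (F := fun d : 'I_h.+1 => (d ^ s)%N) (Ordinal Dlt)).
by rewrite /= Dh dvdn_exp2r.
Qed.

(** The generalized gcd is D^s, which is 1 exactly when D = 1. The sum of [moebius] over the
    divisors of [D] detects this, and those divisors are the d | q with d^s | h. *)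
Lemma gen_gcd_indicator (s q h : nat) : (0 < s)%N -> (0 < q)%N -> (0 < h)%N ->
  (if gen_gcd h (q ^ s) s == 1%N then 1 else 0) =
  \sumR_(d <- divisors q) (if d ^ s %| h then moebius d else 0).
Proof.
move=> s0 q0 h0; have [D D0 HD] := power_gcd_exists s h q0.
rewrite (gen_gcd_power s0 h0 D0 HD).
have -> : (D ^ s == 1)%N = (D == 1)%N by rewrite -{1}(exp1n s) eqn_exp2r.
rewrite -sum_moebius // -[RHS]big_mkcond -[RHS]big_filter.
apply: perm_big; apply: uniq_perm; try exact: divisors_uniq.
  exact: filter_uniq (divisors_uniq _).
by move=> d; rewrite mem_filter -!dvdn_divisors // -HD andbC.
Qed.

(** * Sums of roots of unity *)

Lemma cisD (a b : R) : cis (a + b) = (cis a * cis b)%C.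
Proof. by rewrite /cis cos_plus sin_plus /Cmult /=; congr pair; ring. Qed.

Lemma cis_2PI (k : nat) : cis (2 * PI * INR k) = RtoC 1.
Proof.
elim: k => [|k IH]; first by rewrite /cis Rmult_0_r cos_0 sin_0.
have -> : 2 * PI * INR k.+1 = 2 * PI * INR k + 2 * PI by rewrite S_INR; ring.
by rewrite cisD IH /cis cos_2PI sin_2PI Cmult_1_l.
Qed.

Lemma cos_lt1 (x : R) : 0 < x < 2 * PI -> cos x < 1.
Proof.
move=> [x0 x2]; have -> : x = 2 * (x / 2) by field.
rewrite cos_2a_sin; have := sin_gt_0 (x / 2); nra.
Qed.

(** Reducing [m] modulo [N] brings the angle into [0, 2 PI), where the cosine equals 1 only at 0. *)
Lemma cis_eq1_dvdn (N m : nat) : (0 < N)%N ->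
  cis (2 * PI * (INR m / INR N)) = RtoC 1 -> N %| m.
Proof.
move=> N0; have NR : 0 < INR N by apply: lt_0_INR; apply/ltP.
rewrite {1}(divn_eq m N) plus_INR mult_INR.
have -> : 2 * PI * ((INR (m %/ N) * INR N + INR (m %% N)) / INR N) =
  2 * PI * INR (m %/ N) + 2 * PI * (INR (m %% N) / INR N) by field; lra.
rewrite cisD cis_2PI Cmult_1_l => -[c1 _].
rewrite /dvdn -leqn0 leqNgt; apply/negP => r0; move: c1.
apply: Rlt_not_eq; apply: cos_lt1; have pi0 := PI_RGT_0.
have r1 : 0 < INR (m %% N) by apply: lt_0_INR; apply/ltP.
have r2 : INR (m %% N) < INR N by apply: lt_INR; apply/ltP; rewrite ltn_mod.
have q0 : 0 < INR (m %% N) / INR N by apply: Rdiv_lt_0_compat.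
have q1 : INR (m %% N) / INR N < 1 by apply/Rlt_div_l => //; lra.
by nra.
Qed.

(** If N | m, every term is 1. Otherwise multiplication by the first term [z] permutes the terms
    cyclically, so zS = S with z different from 1, which forces S = 0. *)
Lemma sum_roots_of_unity (N m : nat) : (0 < N)%N ->
  \big[Cplus/RtoC 0]_(1 <= j < N.+1) cis (2 * PI * (INR m * INR j / INR N)) =
  RtoC (if N %| m then INR N else 0).
Proof.
move=> N0; have NR : 0 < INR N by apply: lt_0_INR; apply/ltP.
case: ifP => [/dvdnP[t ->] | Nm].
  rewrite (eq_bigr (fun _ => RtoC 1)) => [|j _]; last first.
    rewrite -(cis_2PI (t * j)) !mult_INR; congr cis; field; lra.
  rewrite big_add1 /=; elim: {NR N0} N => [|N IH]; first by rewrite big_geq.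
  by rewrite big_nat_recr // IH S_INR RtoC_plus.
pose F j := cis (2 * PI * (INR m * INR j / INR N)).
rewrite -[LHS]/(\big[Cplus/RtoC 0]_(1 <= j < N.+1) F j).
set S := (X in X = _); set z := F 1%N.
have zS : (z * S)%C = S.
  have FS j : (z * F j)%C = F j.+1.
    by rewrite /z /F -cisD; congr cis; rewrite (S_INR j) [INR 1]/=; field; lra.
  rewrite /S (big_morph (Cmult z) (Cmult_plus_distr_l z) (Cmult_0_r z)).
  rewrite (eq_bigr _ (fun j _ => FS j)) big_nat_recr //= [RHS]big_ltn //=.
  rewrite [RHS]Cplus_comm [in RHS]big_add1 /=; congr Cplus.
  (* The shift ends with z times [F N]; as [F N] is 1, this is the first term again. *)
  rewrite -FS /z; have -> : F N = RtoC 1; last by rewrite Cmult_1_r.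
  by rewrite -(cis_2PI m) /F; congr cis; field; lra.
have z1 : (z - RtoC 1)%C <> RtoC 0.
  move=> /(proj2 (Ceq_minus _ _)) ez; move: Nm; rewrite (@cis_eq1_dvdn N m) //.
  by rewrite -ez /z /F; congr cis; rewrite /=; field; lra.
have : ((z - RtoC 1) * S)%C = RtoC 0.
  by transitivity (z * S - S)%C; [ring | rewrite zS; ring].
move=> e; rewrite -(Cmult_1_l S) -(Cinv_l _ z1) -Cmult_assoc e; ring.
Qed.

(** * Divisor-sum formula for the Cohen-Ramanujan sum *)

Lemma RtoC_sum (I : Type) (r : seq I) (F : I -> R) :
  RtoC (\big[Rplus/0]_(i <- r) F i) = \big[Cplus/RtoC 0]_(i <- r) RtoC (F i).
Proof. by apply: (big_morph RtoC) => // x y; rewrite RtoC_plus. Qed.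

Definition power_indicator (s n k : nat) : R := if k %| n then INR k ^ s else 0.

(** The value of c_q at n^s as a real number, so that the analysis can be carried out on the real
    and imaginary parts of [f] separately. *)
Definition real_ramanujan (s n q : nat) : R :=
  \sumR_(d <- divisors q) moebius d * power_indicator s n (q %/ d)%N.

(** The gcd condition is expanded by [gen_gcd_indicator] and the sums are exchanged. For fixed [d] a
    full sum of roots of unity of order (q/d)^s remains. *)
Lemma cohen_ramanujanE (s q n : nat) : (0 < s)%N -> (0 < q)%N ->
  cohen_ramanujan q s (n ^ s) = RtoC (real_ramanujan s n q).
Proof.
move=> s0 q0; rewrite /real_ramanujan /power_indicator.
rewrite /cohen_ramanujan sum_n_m_bigC.
pose e h := cis (2 * PI * (INR (n ^ s) * INR h / INR (q ^ s))).
have E h : (0 < h)%N ->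
  (if gen_gcd h (q ^ s) s == 1%N then e h else RtoC 0) =
  \sumC_(d <- divisors q) (RtoC (moebius d) * (if (d ^ s)%N %| h then e h else RtoC 0))%C.
  move=> h0; transitivity (RtoC (if gen_gcd h (q ^ s) s == 1%N then 1 else 0) * e h)%C.
    by case: ifP => _; ring.
  rewrite gen_gcd_indicator // RtoC_sum.
  rewrite (big_morph (fun x => x * e h)%C (fun x y => Cmult_plus_distr_r x y _) (Cmult_0_l _)).
  by apply: eq_bigr => d _; case: ifP => _; ring.
rewrite (eq_big_nat _ _ (F2 := fun h => _) (fun h hh => E h (proj1 (andP hh)))).
rewrite exchange_big RtoC_sum; apply: eq_big_seq => d; rewrite -dvdn_divisors // => dq.
rewrite -(big_morph (Cmult _) (Cmult_plus_distr_l _) (Cmult_0_r _)) RtoC_mult.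
congr Cmult; rewrite -big_mkcond /=.
have d0 : (0 < d)%N := dvdn_gt0 q0 dq.
have ds0 : (0 < d ^ s)%N by rewrite expn_gt0 d0.
have qd0 : (0 < q %/ d)%N by rewrite divn_gt0 // dvdn_leq.
have qE : (q ^ s = (q %/ d) ^ s * d ^ s)%N by rewrite -expnMn divnK.
(* Only h = j d^s with 1 <= j <= (q/d)^s survive. *)
rewrite qE big_multiples //.
(* The condition q/d | n is raised to s-th powers, the form produced by the root-of-unity sum. *)
rewrite -(dvdn_pexp2r _ n s0).
have -> : INR (q %/ d) ^ s = INR ((q %/ d) ^ s).
  elim: s {s0 E e ds0 qE} => [|s IH] //; by rewrite expnS mult_INR -IH.
rewrite -sum_roots_of_unity ?expn_gt0 ?qd0 //.
apply: eq_bigr => j _; rewrite /e qE !mult_INR; congr cis.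
have dR : 0 < INR (d ^ s) by apply: lt_0_INR; apply/ltP.
have qR : 0 < INR ((q %/ d) ^ s) by apply: lt_0_INR; apply/ltP; rewrite expn_gt0 qd0.
by field; lra.
Qed.

(** * Series over multiples and over divisors *)

Lemma sum_n_bigR (v : nat -> R) (N : nat) :
  sum_n (fun k => v k.+1) N = \big[Rplus/R0]_(1 <= k < N.+2) v k.
Proof.
elim: N => [|N IH]; first by rewrite sum_O big_nat1.
by rewrite sum_Sn IH [RHS]big_nat_recr.
Qed.

(** The partial sums of the new series are those of the old one at the indices [phi M], and a
    subsequence keeps the limit. *)
Lemma is_series_multiples (b : nat -> R) (q : nat) (l : R) : (0 < q)%N ->
  is_series (fun k => if q %| k.+1 then b k.+1 else 0) l ->
  is_series (fun m => b (m.+1 * q)%N) l.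
Proof.
move=> q0 H; pose phi m := (m.+1 * q).-1.
have phiS m : (phi m).+1 = (m.+1 * q)%N by rewrite prednK // muln_gt0.
apply: (filterlim_ext (fun M => sum_n (fun k => if q %| k.+1 then b k.+1 else 0) (phi M))).
  move=> M; rewrite (sum_n_bigR (fun k => if q %| k then b k else 0)) phiS.
  by rewrite -big_mkcond big_multiples // -(sum_n_bigR (fun m => b (m * q)%N)).
apply: filterlim_comp H; apply: eventually_subseq => m.
by apply/ltP; rewrite -ltnS !phiS ltn_pmul2r.
Qed.

Lemma is_series_finite_support (u : nat -> R) (n : nat) :
  (forall k, (n <= k)%N -> u k = 0) ->
  is_series u (sum_n u n).
Proof.
move=> u0; apply: (filterlim_ext_loc (fun _ => sum_n u n)); last exact: filterlim_const.
exists n => m /leP nm; rewrite -(subnKC nm); elim: (m - n)%N => [|k IH]; first by rewrite addn0.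
rewrite addnS sum_Sn -IH u0 ?plus_zero_r // -addnS; exact: leq_addr.
Qed.

Lemma is_series_divisors (u : nat -> R) (n : nat) : (0 < n)%N ->
  is_series (fun k => if k.+1 %| n then u k.+1 else 0) (\sumR_(d <- divisors n) u d).
Proof.
move=> n0; have -> : \sumR_(d <- divisors n) u d =
    sum_n (fun k => if k.+1 %| n then u k.+1 else 0) n.
  rewrite (sum_n_bigR (fun k => if k %| n then u k else 0)) -big_mkcond -[RHS]big_filter.
  apply: perm_big; apply: uniq_perm.
  - exact: divisors_uniq.
  - exact: filter_uniq (iota_uniq _ _).
  move=> d; rewrite mem_filter mem_index_iota -dvdn_divisors // ltnS.
  by case dn: (d %| n) => //=; rewrite (dvdn_gt0 n0 dn) leqW // dvdn_leq.
apply: is_series_finite_support => k nk; rewrite ifF //; apply/negP => /(dvdn_leq n0).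
by rewrite leqNgt ltnS nk.
Qed.

(** * Rearranging the double series *)

Lemma Rabs_sum (I : Type) (r : seq I) (F : I -> R) :
  Rabs (\sumR_(i <- r) F i) <= \sumR_(i <- r) Rabs (F i).
Proof.
apply: (big_ind2 (fun x y => Rabs x <= y)) => [|x1 x2 y1 y2 h1 h2|i _].
- by rewrite Rabs_R0; right.
- by apply: Rle_trans (Rabs_triang _ _) _; apply: Rplus_le_compat.
- by right.
Qed.

Lemma ler_sumR (r : seq nat) (F G : nat -> R) :
  (forall i, i \in r -> F i <= G i) ->
  \sumR_(i <- r) F i <= \sumR_(i <- r) G i.
Proof.
move=> FG; rewrite big_seq_cond [X in _ <= X]big_seq_cond.
apply: (big_ind2 Rle) => [|x1 x2 y1 y2|i]; first by right.
  exact: Rplus_le_compat.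
by rewrite andbT; exact: FG.
Qed.

Lemma sumR_ge0 (r : seq nat) (F : nat -> R) :
  (forall i, 0 <= F i) -> 0 <= \sumR_(i <- r) F i.
Proof.
move=> F0; apply: (big_ind (Rle 0)) => [|x y|i _ //]; first by right.
exact: Rplus_le_le_0_compat.
Qed.

(* Only finitely many [q] are summed at a time, so no theorem on double series is
   needed: the terms with [k <= Q] are already complete after summing over
   [q <= Q], and the remaining ones are dominated by a tail of [w]. *)
Lemma is_series_rearrange (b c : nat -> R) :
  ex_series (fun k => Rabs (b k.+1)) ->
  ex_series (fun k => Rabs (b k.+1) * \sumR_(q <- divisors k.+1) Rabs (c q)) ->
  is_series (fun q => Series (fun m => b (m.+1 * q.+1)%N) * c q.+1)
    (Series (fun k => b k.+1 * \sumR_(q <- divisors k.+1) c q)).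
Proof.
move=> hb hw.
set w := fun k => Rabs (b k.+1) * _ in hw.
set t := fun k => b k.+1 * _; set T := Series t.
have tw k : Rabs (t k) <= w k.
  rewrite /t Rabs_mult; apply: Rmult_le_compat_l (Rabs_pos _) (Rabs_sum _ _).
have ht : is_series t T by apply: Series_correct; apply: (ex_series_le t w).
(* [ind q] is [b] restricted to the multiples of [q]; its sum is the inner series over m. *)
pose ind q k := if q %| k.+1 then b k.+1 else 0.
have hA q : is_series (ind q.+1) (Series (fun m => b (m.+1 * q.+1)%N)).
  have e : ex_series (ind q.+1).
    apply: (ex_series_le _ (fun k => Rabs (b k.+1))) => // k.
    rewrite /ind; case: ifP => _; first by right.
    by rewrite norm_zero; exact: Rabs_pos.
  have h := Series_correct _ e.
  by rewrite (is_series_unique _ _ (is_series_multiples (ltn0Sn q) h)).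
(* Summing [p Q] over k gives the outer partial sum, by finitely many additions of convergent
   series. *)
pose p Q k := sum_n (fun q => ind q.+1 k * c q.+1) Q.
set u := fun q => _ * c q.+1.
have hp Q : is_series (p Q) (sum_n u Q).
  elim: Q => [|Q IH].
    rewrite sum_O; apply: (is_series_ext (fun k => ind 1%N k * c 1%N)).
      by move=> k; rewrite /p sum_O.
    by apply: is_series_scal_r; exact: hA.
  rewrite sum_Sn; apply: (is_series_ext (fun k => plus (p Q k) (ind Q.+2 k * c Q.+2))).
    by move=> k; rewrite /p sum_Sn.
  by apply: is_series_plus => //; apply: is_series_scal_r; exact: hA.
have pE Q k : p Q k = b k.+1 * \sumR_(q <- divisors k.+1) (if (q <= Q.+1)%N then c q else 0).
  rewrite /p (sum_n_bigR (fun q => ind q k * c q)).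
  rewrite (big_morph (Rmult _) (Rmult_plus_distr_l _) (Rmult_0_r _)).
  have -> : \big[Rplus/R0]_(1 <= q < Q.+2) (ind q k * c q) =
      \big[Rplus/R0]_(1 <= q < Q.+2) (if q %| k.+1 then b k.+1 * c q else 0).
    by apply: eq_bigr => q _; rewrite /ind; case: ifP => _; ring.
  have -> : \sumR_(q <- divisors k.+1) (b k.+1 * (if (q <= Q.+1)%N then c q else 0)) =
      \sumR_(q <- divisors k.+1) (if (q <= Q.+1)%N then b k.+1 * c q else 0).
    by apply: eq_bigr => q _; case: ifP => _; ring.
  rewrite -big_mkcond -[LHS]big_filter -[RHS]big_mkcond -[RHS]big_filter.
  apply: perm_big; apply: uniq_perm.
  - exact: filter_uniq (iota_uniq _ _).
  - exact: filter_uniq (divisors_uniq _).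
  move=> d; rewrite !mem_filter mem_index_iota -dvdn_divisors // ltnS andbC.
  by case dk: (d %| k.+1); rewrite ?andbF // !andbT (dvdn_gt0 _ dk).
have W := Series_correct _ hw; set Ws := Series w in W.
have bound Q : Rabs (sum_n u Q.+1 - T) <= Ws - sum_n w Q.
  pose D k := t k - p Q.+1 k.
  have hD : is_series D (T - sum_n u Q.+1) by apply: is_series_minus.
  (* [D k] retains only the divisors of k+1 that exceed Q+2, hence the bound by the full absolute
     sum. *)
  have Dw k : Rabs (D k) <= w k.
    rewrite /D /t pE -Rmult_minus_distr_l Rabs_mult.
    apply: Rmult_le_compat_l; first exact: Rabs_pos.
    apply: Rle_trans (_ : \sumR_(q <- divisors k.+1) Rabs (if (q <= Q.+2)%N then 0 else c q) <= _).
      apply: Rle_trans (Rabs_sum _ _); right; congr Rabs.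
      rewrite /Rminus (big_morph Ropp Ropp_plus_distr Ropp_0) -big_split /=.
      by apply: eq_bigr => q _; case: ifP => _; ring.
    apply: ler_sumR => q _; case: ifP => _; first by rewrite Rabs_R0; exact: Rabs_pos.
    by right.
  (* A divisor of k+1 is at most Q+1, so the truncation at Q+2 removes nothing. *)
  have D0 k : (k <= Q)%N -> D k = 0.
    move=> kQ; rewrite /D /t pE.
    rewrite [X in _ - _ * X](eq_big_seq c); first by rewrite Rminus_diag.
    move=> q; rewrite -dvdn_divisors // => /(dvdn_leq (ltn0Sn k)) qk.
    by rewrite ifT // (leq_trans qk) // ltnS leqW.
  have sD : sum_n D Q = 0.
    rewrite (sum_n_ext_loc _ (fun _ => 0)) ?sum_n_const ?Rmult_0_r // => k /leP.
    exact: D0.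
  have hD' : is_series (fun k => D (Q.+1 + k)%N) (T - sum_n u Q.+1).
    apply: (is_series_incr_n D Q.+1); first exact: Nat.lt_0_succ.
    by rewrite [Init.Nat.pred _]/= sD plus_zero_r.
  have hw' : is_series (fun k => w (Q.+1 + k)%N) (Ws - sum_n w Q).
    apply: (is_series_incr_n w Q.+1); first exact: Nat.lt_0_succ.
    by rewrite [Init.Nat.pred _]/= /plus /= Rplus_assoc Rplus_opp_l Rplus_0_r.
  rewrite Rabs_minus_sym -(is_series_unique _ _ hD') -(is_series_unique _ _ hw').
  have ex : ex_series (fun k => Rabs (D (Q.+1 + k)%N)).
    apply: (ex_series_le _ (fun k => w (Q.+1 + k)%N)); last by exists (Ws - sum_n w Q).
    by move=> k; rewrite /norm /= /abs /= Rabs_Rabsolu.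
  apply: Rle_trans (Series_Rabs _ ex) _; apply: Series_le => [k|]; last by exists (Ws - sum_n w Q).
  by split; [exact: Rabs_pos | exact: Dw].
have lim0 : is_lim_seq (fun Q => Ws - sum_n w Q) 0.
  have -> : Rbar.Finite 0 = Rbar.Finite (Ws - Ws) by rewrite Rminus_diag.
  by apply: is_lim_seq_minus'; [exact: is_lim_seq_const | exact: W].
suff : is_lim_seq (sum_n u) T by [].
(* The bound concerns the partial sum at Q+1, so the shifted sequence is considered. *)
apply/is_lim_seq_incr_1.
have -> : Rbar.Finite T = Rbar.Finite (T + 0) by rewrite Rplus_0_r.
apply: (is_lim_seq_ext (fun Q => T + (sum_n u Q.+1 - T))); first by move=> Q; ring.
apply: is_lim_seq_plus'; first exact: is_lim_seq_const.
apply/is_lim_seq_abs_0; apply: is_lim_seq_le_le lim0; last exact: is_lim_seq_const.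
by move=> Q; split; [exact: Rabs_pos | exact: bound].
Qed.

(** * Absolute bounds for the Ramanujan sums *)

Lemma power_indicator_ge0 (s n k : nat) : 0 <= power_indicator s n k.
Proof. by rewrite /power_indicator; case: ifP => _; [apply/pow_le/pos_INR | right]. Qed.

Lemma omega_dvdn (d k : nat) : (0 < k)%N -> d %| k -> (omega d <= omega k)%N.
Proof.
move=> k0 dk; apply: uniq_leq_size; first exact: primes_uniq.
move=> p; rewrite !mem_primes k0 => /and3P[-> _ pd].
by rewrite (dvdn_trans pd dk).
Qed.

(** Only common divisors of [k] and [n] contribute; allowing all divisors of [n] makes the bound
    independent of [k]. *)
Lemma sum_power_indicator_le (s n k : nat) : (0 < k)%N -> (0 < n)%N ->
  \sumR_(e <- divisors k) power_indicator s n e <= \sumR_(e <- divisors n) INR e ^ s.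
Proof.
move=> k0 n0; apply: Rle_trans (_ : \sumR_(e <- divisors n) (if e %| k then INR e ^ s else 0) <= _).
  right; rewrite /power_indicator -[LHS]big_mkcond -[LHS]big_filter.
  rewrite -[RHS]big_mkcond -[RHS]big_filter.
  apply: perm_big; apply: uniq_perm; try exact: filter_uniq (divisors_uniq _).
  by move=> d; rewrite !mem_filter -!dvdn_divisors // andbC.
apply: ler_sumR => e _; case: ifP => _; first by right.
exact/pow_le/pos_INR.
Qed.

(** After the triangle inequality and the swap, each [e] carries the factor 2^omega(k/e), which is
    at most 2^omega(k). This is the source of the weight in the summability hypothesis. *)
Lemma sum_abs_ramanujan (s n k : nat) : (0 < k)%N -> (0 < n)%N ->
  \sumR_(q <- divisors k) Rabs (real_ramanujan s n q) <=
  2 ^ omega k * \sumR_(e <- divisors n) INR e ^ s.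
Proof.
move=> k0 n0.
pose G d e := Rabs (moebius d) * power_indicator s n e.
apply: Rle_trans (_ : \sumR_(q <- divisors k) (\sumR_(d <- divisors q) G d (q %/ d)%N) <= _).
  apply: ler_sumR => q _; apply: Rle_trans (Rabs_sum _ _) _.
  right; apply: eq_bigr => d _.
  by rewrite Rabs_mult (Rabs_pos_eq (power_indicator _ _ _)) //; exact: power_indicator_ge0.
rewrite (sum_divisors_swap _ G k0).
apply: Rle_trans (_ : \sumR_(e <- divisors k) (2 ^ omega k * power_indicator s n e) <= _).
  apply: ler_sumR => e; rewrite -dvdn_divisors // => ek.
  have e0 : (0 < e)%N := dvdn_gt0 k0 ek.
  have ke0 : (0 < k %/ e)%N by rewrite divn_gt0 // dvdn_leq.
  rewrite -(big_morph (fun x => x * power_indicator s n e)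
    (fun x y => Rmult_plus_distr_r x y _) (Rmult_0_l _)).
  rewrite sum_abs_moebius //; apply: Rmult_le_compat_r; first exact: power_indicator_ge0.
  apply: Rle_pow; first lra.
  by apply/leP; apply: omega_dvdn => //; exact: dvdn_div.
rewrite -(big_morph (Rmult _) (Rmult_plus_distr_l _) (Rmult_0_r _)).
apply: Rmult_le_compat_l; first by apply: pow_le; lra.
exact: sum_power_indicator_le.
Qed.

Lemma ex_series_weight (b : nat -> R) :
  ex_series (fun k => 2 ^ omega k.+1 * Rabs (b k.+1)) ->
  ex_series (fun k => Rabs (b k.+1)).
Proof.
move=> hb; apply: (ex_series_le _ _ _ hb) => k.
rewrite /norm /= /abs /= Rabs_Rabsolu -[X in X <= _]Rmult_1_l.
apply: Rmult_le_compat_r; first exact: Rabs_pos.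
by apply: pow_R1_Rle; lra.
Qed.

Lemma ex_series_ramanujan (s n : nat) (b : nat -> R) : (0 < n)%N ->
  ex_series (fun k => 2 ^ omega k.+1 * Rabs (b k.+1)) ->
  ex_series (fun k => Rabs (b k.+1) *
                      \sumR_(q <- divisors k.+1) Rabs (real_ramanujan s n q)).
Proof.
move=> n0 hb; set K := \sumR_(e <- divisors n) INR e ^ s.
apply: (ex_series_le _ _ _ (ex_series_scal_r K _ hb)) => k.
have S0 : 0 <= \sumR_(q <- divisors k.+1) Rabs (real_ramanujan s n q).
  by apply: sumR_ge0 => q; exact: Rabs_pos.
rewrite /norm /= /abs /= Rabs_mult Rabs_Rabsolu (Rabs_pos_eq _ S0).
have := sum_abs_ramanujan s (ltn0Sn k) n0; rewrite -/K => le.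
have := Rmult_le_compat_l _ _ _ (Rabs_pos (b k.+1)) le.
by move/Rle_trans; apply; right; ring.
Qed.

(** * The expansion of a real-valued function *)

(** After rearrangement the Ramanujan sums over q | k add up to k^s or 0 as k divides [n] or not.
    The power cancels the denominator, and the sum of g' over the divisors of [n] is [g n]. *)
Lemma is_series_ramanujan (s n : nat) (g : nat -> R) : (0 < n)%N ->
  let g' k := \sumR_(d <- divisors k) moebius d * g (k %/ d)%N in
  ex_series (fun k => 2 ^ omega k.+1 * Rabs (g' k.+1 / INR k.+1 ^ s)) ->
  is_series (fun q => Series (fun m => g' (m.+1 * q.+1)%N / INR (m.+1 * q.+1) ^ s) *
                      real_ramanujan s n q.+1) (g n).
Proof.
move=> n0 g' hg; set b := fun k => g' k / INR k ^ s.
have := is_series_rearrange (b := b) (c := real_ramanujan s n)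
  (ex_series_weight hg) (ex_series_ramanujan s n0 hg).
suff -> : Series (fun k => b k.+1 * \sumR_(q <- divisors k.+1) real_ramanujan s n q) = g n by [].
apply: is_series_unique; rewrite -(moebius_inversion g n0).
have E k : (if k.+1 %| n then g' k.+1 else 0) =
    b k.+1 * \sumR_(q <- divisors k.+1) real_ramanujan s n q.
  rewrite moebius_inversion // /power_indicator /b; case: ifP => _; last by ring.
  have k0 : INR k.+1 ^ s <> 0 by apply: pow_nonzero; exact: not_0_INR.
  by field.
exact: (is_series_ext _ _ _ E (is_series_divisors (u := g') n0)).
Qed.

Lemma ex_series_multiples (b : nat -> R) (q : nat) : (0 < q)%N ->
  ex_series (fun k => Rabs (b k.+1)) -> ex_series (fun m => Rabs (b (m.+1 * q)%N)).
Proof.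
move=> q0 hb.
have [l hl] : ex_series (fun k => if q %| k.+1 then Rabs (b k.+1) else 0).
  apply: (ex_series_le _ _ _ hb) => k; case: ifP => _.
    by rewrite /norm /= /abs /= Rabs_Rabsolu; right.
  by rewrite norm_zero; exact: Rabs_pos.
by exists l; apply: (is_series_multiples (b := fun k => Rabs (b k))).
Qed.

(** * From real to complex series *)

Lemma is_series_C (u : nat -> C) (l : C) :
  is_series (fun k => Re (u k)) (Re l) -> is_series (fun k => Im (u k)) (Im l) ->
  is_series u l.
Proof.
move=> hr hi.
have E N : sum_n u N = (sum_n (fun k => Re (u k)) N, sum_n (fun k => Im (u k)) N).
  elim: N => [|N IH]; first by rewrite !sum_O; case: (u 0%N).
  by rewrite !sum_Sn IH.
apply: (filterlim_ext (fun N => (sum_n (fun k => Re (u k)) N, sum_n (fun k => Im (u k)) N))).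
  by move=> N; rewrite E.
apply/filterlim_locally => eps.
have /filterlim_locally/(_ eps) Hr := hr; have /filterlim_locally/(_ eps) Hi := hi.
apply: filter_imp (filter_and _ _ Hr Hi) => N [h1 h2]; exact: (conj h1 h2).
Qed.

Lemma Cmod_le_abs (z : C) : Cmod z <= Rabs (Re z) + Rabs (Im z).
Proof.
have zE : z = (RtoC (Re z) + Ci * RtoC (Im z))%C.
  by case: z => x y; rewrite /Cplus /Cmult /=; congr pair; ring.
rewrite {1}zE; apply: Rle_trans (Cmod_triangle _ _) _.
rewrite Cmod_mult !Cmod_R; right; congr (_ + _).
by rewrite -[RHS]Rmult_1_l; congr (_ * _); rewrite /Cmod /= !Rmult_0_l Rplus_0_l !Rmult_1_r sqrt_1.
Qed.

Lemma Re_le_Cmod (z : C) : Rabs (Re z) <= Cmod z.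
Proof. exact: Rle_trans (Rmax_l _ _) (Rmax_Cmod z). Qed.

Lemma Im_le_Cmod (z : C) : Rabs (Im z) <= Cmod z.
Proof. exact: Rle_trans (Rmax_r _ _) (Rmax_Cmod z). Qed.

(** [CSeries] is defined by components; each is bounded by the series of moduli, whence the factor
    2, which does no harm to convergence. *)
Lemma Cmod_CSeries (u : nat -> C) : ex_series (fun k => Cmod (u k)) ->
  Cmod (CSeries u) <= 2 * Series (fun k => Cmod (u k)).
Proof.
move=> hu.
have bound (p : C -> R) : (forall z, Rabs (p z) <= Cmod z) ->
    Rabs (Series (fun k => p (u k))) <= Series (fun k => Cmod (u k)).
  move=> hp; apply: Rle_trans (Series_Rabs _ _) _.
    apply: (ex_series_le _ _ _ hu) => k.
    by rewrite /norm /= /abs /= Rabs_Rabsolu.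
  by apply: Series_le => // k; split; [exact: Rabs_pos | exact: hp].
have := Cmod_le_abs (CSeries u).
have := bound Re Re_le_Cmod; have := bound Im Im_le_Cmod; rewrite /CSeries /=; lra.
Qed.

Lemma INR_pow_gt0 (k r : nat) : (0 < k)%N -> 0 < INR k ^ r.
Proof. by move=> k0; apply/pow_lt/lt_0_INR/ltP. Qed.

(** * Absolute convergence and sum of the expansion of [f] *)

Section Expansion.

Variables (s : nat) (f : nat -> C) (n : nat).
Hypotheses (s0 : (0 < s)%N) (n0 : (0 < n)%N).
Hypothesis hsum : ex_series (fun k : nat =>
  2 ^ omega k.+1 * Cmod (mobius_conv f k.+1) / INR k.+1 ^ s).

Let term_abs k := Cmod (mobius_conv f k) / INR k ^ s.
Let c q := cohen_ramanujan q s (n ^ s).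

Lemma term_abs_ge0 (k : nat) : 0 <= term_abs k.+1.
Proof. by apply: Rle_mult_inv_pos (Cmod_ge_0 _) _; exact: INR_pow_gt0. Qed.

Lemma ex_series_weighted_term_abs : ex_series (fun k => 2 ^ omega k.+1 * Rabs (term_abs k.+1)).
Proof.
apply: (ex_series_ext _ _ _ hsum) => k; rewrite Rabs_pos_eq; last exact: term_abs_ge0.
by rewrite /term_abs /Rdiv Rmult_assoc.
Qed.

(** The function [p] stands for [Re] or [Im], so both parts are handled at once. *)
Lemma ex_series_weighted_part (p : C -> R) : (forall z, Rabs (p z) <= Cmod z) ->
  ex_series (fun k => 2 ^ omega k.+1 * Rabs (p (mobius_conv f k.+1) / INR k.+1 ^ s)).
Proof.
move=> hp; apply: (ex_series_le _ _ _ ex_series_weighted_term_abs) => k.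
have k0 : 0 < INR k.+1 ^ s by exact: INR_pow_gt0.
have w0 : 0 <= 2 ^ omega k.+1 by apply: pow_le; lra.
rewrite /norm /= /abs /= Rabs_mult Rabs_Rabsolu (Rabs_pos_eq _ w0).
apply: Rmult_le_compat_l => //; rewrite /term_abs /Rdiv !Rabs_mult.
apply: Rmult_le_compat_r; first exact: Rabs_pos.
by rewrite (Rabs_pos_eq (Cmod _)); [exact: hp | exact: Cmod_ge_0].
Qed.

Lemma expansion_inner (q : nat) :
  ex_series (fun m => term_abs (m.+1 * q.+1)%N * Cmod (c q.+1)).
Proof.
apply: ex_series_scal_r.
apply: (ex_series_ext _ _ _ (ex_series_multiples (ltn0Sn q)
  (ex_series_weight ex_series_weighted_term_abs))) => m.
by rewrite Rabs_pos_eq //; exact: term_abs_ge0.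
Qed.

(** The rearrangement is applied to the nonnegative data |f'(k)|/k^s and |c_q|. *)
Lemma expansion_outer :
  ex_series (fun q => Series (fun m => term_abs (m.+1 * q.+1)%N * Cmod (c q.+1))).
Proof.
have h := is_series_rearrange (b := term_abs) (c := fun q => Rabs (real_ramanujan s n q))
  (ex_series_weight ex_series_weighted_term_abs).
eexists; apply: is_series_ext; last apply: h.
  by move=> q /=; rewrite Series_scal_r /c cohen_ramanujanE // Cmod_R.
apply: (ex_series_ext _ _ _ (ex_series_ramanujan s n0 ex_series_weighted_term_abs)) => k.
by congr (_ * _); apply: eq_bigr => q _; rewrite Rabs_Rabsolu.
Qed.

Lemma Cmod_term (k : nat) : (0 < k)%N ->
  Cmod (mobius_conv f k / RtoC (INR k ^ s))%C = term_abs k.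
Proof.
move=> k0; have r0 := INR_pow_gt0 s k0.
rewrite Cmod_div ?Cmod_R ?Rabs_pos_eq //; try lra.
by move=> /RtoC_inj; lra.
Qed.

(** By [Cmod_CSeries] the terms are at most twice those of [expansion_outer]. *)
Lemma expansion_abs :
  ex_series (fun q => Cmod (coef_a f s q.+1 * c q.+1)%C).
Proof.
apply: (ex_series_le _ _ _ (ex_series_scal_l 2 _ expansion_outer)) => q.
rewrite /norm /= /abs /= Rabs_pos_eq ?Cmod_mult; last first.
  exact: Rmult_le_pos (Cmod_ge_0 _) (Cmod_ge_0 _).
rewrite /scal /= /mult /= Series_scal_r -Rmult_assoc.
apply: Rmult_le_compat_r; first exact: Cmod_ge_0.
have E m : Cmod (mobius_conv f (m.+1 * q.+1) / RtoC (INR (m.+1 * q.+1) ^ s))%C =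
    term_abs (m.+1 * q.+1).
  exact: Cmod_term.
rewrite -(Series_ext _ _ E); apply: Cmod_CSeries.
apply: (ex_series_ext _ _ _ (ex_series_multiples (ltn0Sn q)
  (ex_series_weight ex_series_weighted_term_abs))) => m.
by rewrite E Rabs_pos_eq //; exact: term_abs_ge0.
Qed.

Lemma expansion_part (p : C -> R) : (forall z, Rabs (p z) <= Cmod z) ->
  (forall k, (0 < k)%N ->
     p (mobius_conv f k) = \sumR_(d <- divisors k) moebius d * p (f (k %/ d)%N)) ->
  is_series (fun q => Series (fun m => p (mobius_conv f (m.+1 * q.+1)) / INR (m.+1 * q.+1) ^ s) *
                      real_ramanujan s n q.+1) (p (f n)).
Proof.
move=> hp pE; have h := ex_series_weighted_part hp.
apply: (is_series_ext _ _ _ _ (is_series_ramanujan (s := s) (g := fun k => p (f k)) n0 _)) => [q|].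
  by congr (_ * _); apply: Series_ext => m; rewrite pE.
by apply: (ex_series_ext _ _ _ h) => k; rewrite pE.
Qed.

(** Each c_q is real, so the real and imaginary parts of a_q c_q are those of a_q times c_q, and the
    two parts of [f] expand separately. *)
Lemma expansion_sum :
  is_series (fun q => (coef_a f s q.+1 * c q.+1)%C) (f n).
Proof.
(* Division by k^s is rewritten as multiplication by a real number, from which [Re] and [Im] can be
   extracted. *)
have V k : (0 < k)%N -> (mobius_conv f k / RtoC (INR k ^ s))%C =
    (mobius_conv f k * RtoC (/ INR k ^ s))%C.
  by move=> k0; rewrite RtoC_inv //; have := INR_pow_gt0 s k0; lra.
apply: is_series_C.
- apply: (is_series_ext _ _ _ _ (expansion_part Re_le_Cmod (Re_mobius_conv f))) => q.
  rewrite /c cohen_ramanujanE // re_scal_r; congr (_ * _); apply: Series_ext => m.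
  by rewrite V // re_scal_r.
- apply: (is_series_ext _ _ _ _ (expansion_part Im_le_Cmod (Im_mobius_conv f))) => q.
  rewrite /c cohen_ramanujanE // im_scal_r; congr (_ * _); apply: Series_ext => m.
  by rewrite V // im_scal_r.
Qed.

End Expansion.

(** * Translation from the standard power and order, and the conclusion *)

Lemma Nat_pow_expn (n s : nat) : Nat.pow n s = (n ^ s)%N.
Proof. by elim: s => // s IH; rewrite expnS -IH. Qed.

Lemma positive_ltP (n : nat) : lt 0 n -> (0 < n)%N.
Proof. by move/ltP. Qed.

End DivisorSums.

Theorem theorem2 (s : nat) (hs : (0 < s)%nat) (f : nat -> C)
  (hsum : ex_series (fun k : nat =>
            pow 2 (omega (S k)) * Cmod (mobius_conv f (S k)) / pow (INR (S k)) s)) :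
  forall n : nat, (0 < n)%nat ->
    (forall q : nat, ex_series (fun m : nat =>
        Cmod (mobius_conv f (S m * S q)%nat) / pow (INR (S m * S q)) s
        * Cmod (cohen_ramanujan (S q) s (n ^ s)%nat))) /\
    ex_series (fun q : nat => Series (fun m : nat =>
        Cmod (mobius_conv f (S m * S q)%nat) / pow (INR (S m * S q)) s
        * Cmod (cohen_ramanujan (S q) s (n ^ s)%nat))) /\
    ex_series (fun q : nat =>
        Cmod (coef_a f s (S q) * cohen_ramanujan (S q) s (n ^ s)%nat)%C) /\
    is_series (fun q : nat =>
        (coef_a f s (S q) * cohen_ramanujan (S q) s (n ^ s)%nat)%C) (f n).
Proof.
  intros n hn; rewrite Nat_pow_expn.
  apply positive_ltP in hs; apply positive_ltP in hn.
  split; [|split; [|split]].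
  - exact (expansion_inner n hsum).
  - exact (expansion_outer hs hn hsum).
  - exact (expansion_abs hs hn hsum).
  - exact (expansion_sum hs hn hsum).
Qed.
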